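(* Let $k\ge 1$ and let $n_1,\dots,n_k>0$ be integers. For integers $\nu_1,\dots,\nu_k>0$ let $\theta_{\nu_1,\dots,\nu_k}\in\mathrm{Perm}\big(\sum_i\nu_in_i\big)$ have cycles of length $$\underbrace{n_1,\dots,n_1}_{\nu_1},\dots,\underbrace{n_k,\dots,n_k}_{\nu_k}.$$ Then the generating function $$\sum_{\nu_1=1}^\infty\cdots\sum_{\nu_k=1}^\infty\big|\mathrm{Map}_0(\theta_{\nu_1,\dots,\nu_k})\big|\,\frac{z_1^{\nu_1}\cdots z_k^{\nu_k}}{\nu_1!\cdots\nu_k!}$$ converges for $(z_1,\dots,z_k)$ in a neighborhood of the origin in $\mathbb C^k$.
   Context: $\langle n\rangle=\{1,\dots,n\}$; $\mathrm{Perm}(n)$ is the group of bijections of $\langle n\rangle$; $c(\sigma)$ is the number of cycles of $\sigma\in\mathrm{Perm}(n)$ (fixed points count as cycles). For $\theta\in\mathrm{Perm}(n)$, $\mathrm{Map}_0(\theta)$ is the set of fixed-point-free permutations $\iota\in\mathrm{Perm}(n)$ of order $2$ such that $\theta$ and $\iota$ generate a group acting transitively on $\langle n\rangle$ and $c(\theta)+c(\theta\iota)=2+n/2$. The cardinality $|\mathrm{Map}_0(\theta)|$ depends only on the cycle type of $\theta$. Convergence of a multiple power series is understood, as usual, as absolute convergence. *)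

(* Defs.v *)
From mathcomp Require Export all_boot all_order all_algebra all_fingroup complex.
From mathcomp Require Export all_classical all_reals all_analysis.
Export numFieldNormedType.Exports.

Set Implicit Arguments.
Unset Strict Implicit.
Unset Printing Implicit Defensive.

Local Open Scope classical_set_scope.
Local Open Scope ring_scope.

(* [iota * theta] is the composite x |-> theta (iota x), since MathComp composes
   permutations from left to right; [n./2] is exact because a permutation of
   order 2 without fixed points only exists when n is even. *)
Definition Map0 (n : nat) (theta : 'S_n) : {set 'S_n} :=
  [set iota : 'S_n |
    [&& [forall x, iota x != x],
        #[iota]%g == 2%N,
        [transitive <<[set theta; iota]>>%g, on [set: 'I_n] | 'P] &
        (#|porbits theta| + #|porbits (iota * theta)%g| == 2 + n./2)%N]]%SET.

(* The multiset of cycle lengths of s, in unspecified order: to be compared up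
   to [perm_eq]. *)
Definition cycle_type (n : nat) (s : 'S_n) : seq nat :=
  [seq #|C| | C : {set 'I_n} <- enum (porbits s)].

(* The n_i need not be distinct. *)
Definition blocks (k : nat) (n nu : 'I_k -> nat) : seq nat :=
  flatten [seq nseq (nu i) (n i) | i <- enum 'I_k].

Definition monomial_exp (R : realType) (k : nat) (z : 'rV[R[i]]_k)
    (nu : 'I_k -> nat) : R[i] :=
  (\prod_(i < k) z ord0 i ^+ nu i) / (\prod_(i < k) (nu i)`!%:R).

Definition abs_convergent (R : realType) (T : choiceType) (A : set T)
    (f : T -> R[i]) : Prop :=
  summable A (fun x => (Normc.normc (f x))%:E).

(* Main.v *)
Require Import Defs.
From mathcomp Require Import zify ring lra.

Set Implicit Arguments.
Unset Strict Implicit.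
Unset Printing Implicit Defensive.

(* Since multinomial coefficients grow at most exponentially, it suffices to bound
   [#|Map0 theta|] by [8 ^ N * c(theta)!].  Let [iota] be in
   [Map0 theta].  By connectedness some of the transpositions of [iota] form a
   spanning tree: their product [s] makes [s * theta] a single [N]-cycle, the
   contour of the tree.  Multiplying by a transposition changes the number of
   cycles by one, so the genus-zero relation forces both [s] and the remaining
   part [s * iota] to be noncrossing along the contour.  A noncrossing involution
   is determined by its openers and closers; so [iota] is determined by two bits
   for each of the [N] steps of the contour, together with the [c(theta) - 1]
   points at which the walk enters a new vertex, which are distinct.  This leaves
   at most [4 ^ N * N ^_ (c(theta) - 1)] possibilities. *)

(** * Involutions as products of transpositions, and cycle counts *)

Definition moved (T : finType) (s : {perm T}) : {set T} := [set x | s x != x].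

(* [mulgA] leaves coercions in the operands that [lia] fails to identify. *)
Lemma perm_mulgA (T : finType) (a b c : {perm T}) : (a * (b * c) = a * b * c)%g.
Proof. exact: mulgA. Qed.

Lemma involutive_tperm_mul (T : finType) (s : {perm T}) (x : T) :
    involutive s -> s x != x ->
  exists s' : {perm T},
    [/\ involutive s', s = (tperm x (s x) * s')%g, s = (s' * tperm x (s x))%g,
        forall y, s' y = if y \in [set x; s x] then y else s y &
        #|moved s| = (#|moved s'| + 2)%N].
Proof.
move=> sK sx; set t := tperm x (s x).
have s'E y : (t * s)%g y = if y \in [set x; s x] then y else s y.
  rewrite permM !inE /t; case: tpermP => [->|->|/eqP/negPf -> /eqP/negPf -> //].
  - by rewrite eqxx sK.
  - by rewrite eqxx orbT.
have sE : s = (t * (t * s))%g by rewrite mulgA tperm2 mul1g.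
have s'K : involutive (t * s)%g.
  move=> y; rewrite (s'E y); case: ifP => yx; rewrite s'E ?yx //.
  suff /negPf -> : s y \notin [set x; s x] by rewrite sK.
  apply: contraFN yx; rewrite !inE => /orP[] /eqP e.
    by rewrite -e sK eqxx orbT.
  by rewrite (perm_inj e) eqxx.
exists (t * s)%g; split=> //.
- apply/permP => y; have st : (s * s = 1)%g by apply/permP=> z; rewrite permM perm1 sK.
  have ss : ((t * s) * (t * s) = 1)%g by apply/permP=> z; rewrite permM perm1 s'K.
  suff <- : s = (t * s * t)%g by [].
  by apply: (mulIg s); rewrite st -mulgA ss.
- have -> : moved (t * s)%g = (moved s) :\: [set x; s x].
    apply/setP => y; rewrite finset.in_setD !inE s'E !inE.
    by case: (_ || _) => //; rewrite eqxx.
  rewrite -(cardsID [set x; s x] (moved s)) addnC; congr addn.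
  rewrite (finset.setIidPr _) ?cards2 1?eq_sym ?sx //.
  by apply/fintype.subsetP => y; rewrite !inE => /orP[] /eqP -> //; rewrite sK eq_sym.
Qed.

Definition cycles (T : finType) (s : {perm T}) : nat := #|porbits s|.

Lemma cycles_tperm_mul (T : finType) (s : {perm T}) (x y : T) :
  cycles (tperm x y * s)%g + (x \notin porbit s y).*2 = cycles s + (x != y).
Proof. exact: porbits_mul_tperm. Qed.

Lemma cycles_tperm_mul_le (T : finType) (x y : T) (s : {perm T}) :
  cycles (tperm x y * s)%g <= (cycles s).+1.
Proof. by have := cycles_tperm_mul s x y; case: (x != y); lia. Qed.

(** Each transposition of [t] creates at most one cycle, and [#|moved t|] is twice their number. *)
Lemma cycles_involutive_mul_le (T : finType) (t s : {perm T}) : involutive t ->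
  2 * cycles (t * s)%g <= 2 * cycles s + #|moved t|.
Proof.
have [m] := ubnP #|moved t|; elim: m t => // m IH t tm tK.
have [/eqP|[x]] := set_0Vmem (moved t).
  rewrite -finset.subset0 => /fintype.subsetP t0; suff -> : t = 1%g by rewrite mul1g leq_addr.
  apply/permP => x; rewrite perm1; apply/eqP/negPn/negP => tx.
  by have := t0 x; rewrite !inE => /(_ tx).
rewrite inE => tx; have [t' [t'K tE _ _ ct]] := involutive_tperm_mul tK tx.
have t'm : #|moved t'| < m by lia.
have := IH t' t'm t'K; have := cycles_tperm_mul_le x (t x) (t' * s)%g.
by rewrite perm_mulgA -tE; lia.
Qed.

(** * The spanning tree *)

Lemma porbit_full (T : finType) (s : {perm T}) (x : T) :
  cycles s = 1 -> porbit s x = [set: T].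
Proof.
move/eqP/cards1P => [B BE]; apply/setP => y; rewrite inE.
have : porbit s y \in porbits s by apply: imset_f.
have : porbit s x \in porbits s by apply: imset_f.
by rewrite BE !inE => /eqP -> /eqP <-; apply: porbit_id.
Qed.

Lemma porbit_subset (T : finType) (s : {perm T}) (A : {set T}) (x : T) :
  (forall y, y \in A -> s y \in A) -> x \in A -> porbit s x \subset A.
Proof.
move=> sA xA; apply/fintype.subsetP => y /porbitP[i ->].
by elim: i => [|i IH]; rewrite ?perm1 // expgSr permM sA.
Qed.

(** A cycle of [s] is stable under [theta] and [iota], hence under the group they generate, so by
    transitivity it is everything. The count is 0 when [T] is empty. *)
Lemma cycles_transitive_le1 (T : finType) (theta iota s : {perm T}) :
    [transitive <<[set theta; iota]>>%g, on [set: T] | 'P] ->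
    (forall x, theta x \in porbit s x) -> (forall x, iota x \in porbit s x) ->
  cycles s <= 1.
Proof.
move=> tr th io.
have full x : porbit s x = [set: T].
  have sub : (<<[set theta; iota]>> \subset 'N(porbit s x | 'P))%g.
    rewrite gen_subG; apply/fintype.subsetP => a; rewrite !inE => aE.
    have ay y : a y \in porbit s y by case/orP: aE => /eqP ->.
    apply/fintype.subsetP => y yx; rewrite inE /= apermE.
    by move: yx (ay y); rewrite -!eq_porbit_mem => /eqP ->.
  apply/setP => y; rewrite inE.
  have [a aG ->] := atransP2 tr (finset.in_setT x) (finset.in_setT y).
  by rewrite (astabs_act _ (fintype.subsetP sub _ aG)) porbit_id.
rewrite leqNgt; apply/negP => /card_gt1P [A [B []]].
by move=> /imsetP[x _ ->] /imsetP[y _ ->]; rewrite !full eqxx.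
Qed.

(** Edges are added one at a time: while [s * theta] has several cycles, some transposition of
    [iota] joins two of them, and multiplying by it merges them. Here [j] counts the edges. *)
Lemma exists_partial_tree_part (T : finType) (theta iota : {perm T}) :
    involutive iota ->
    [transitive <<[set theta; iota]>>%g, on [set: T] | 'P] ->
    forall j, j < cycles theta ->
  exists s : {perm T},
    [/\ involutive s, forall x, s x = x \/ s x = iota x,
        #|moved s| = 2 * j & cycles (s * theta)%g + j = cycles theta].
Proof.
move=> iK tr; elim=> [|j IH] lt_j.
  exists 1%g; split; rewrite ?mul1g ?addn0 //; try by move=> x; rewrite !perm1; auto.
  by apply: eq_card0 => x; rewrite !inE perm1 eqxx.
have [s [sK sE ms cs]] := IH (ltnW lt_j).
(* Otherwise [iota], and with it [theta], would preserve every cycle of [s * theta], leaving at most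
   one cycle. *)
have [x xN] : exists x, iota x \notin porbit (s * theta)%g x.
  apply: contrapT => /forallNP all.
  have io x : iota x \in porbit (s * theta)%g x by apply/negPn/negP; exact: all.
  suff : cycles (s * theta)%g <= 1 by lia.
  apply: (cycles_transitive_le1 tr) => // x.
  have -> : theta x = (s * theta)%g (s x) by rewrite permM sK.
  rewrite -eq_porbit_mem; have := porbit_perm (s * theta)%g 1 (s x).
  by rewrite expg1 => ->; rewrite eq_porbit_mem; case: (sE x) => ->; rewrite ?porbit_id.
have ix : iota x != x by apply: contraNneq xN => ->; rewrite porbit_id.
have merge := cycles_tperm_mul (s * theta)%g (iota x) x.
rewrite /= xN ix /= in merge.
have sx : s x = x.
  (* Otherwise removing the transposition [(x iota x)] from [s] would lose a cycle
     instead of gaining one, leaving too few transpositions to reach [theta]. *)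
  case: (sE x) => // sx; exfalso.
  have sxN : s x != x by rewrite sx.
  have [s' [s'K s'1 _ _ ms']] := involutive_tperm_mul sK sxN.
  have := cycles_involutive_mul_le (s' * theta)%g s'K.
  have -> : (s' * (s' * theta) = theta)%g.
    by apply/permP => y; rewrite !permM s'K.
  move: merge; rewrite {1}s'1 sx tpermC -!perm_mulgA.
  rewrite [(tperm _ _ * (_ * _))%g]perm_mulgA tperm2 mul1g.
  lia.
have six : s (iota x) = iota x.
  by case: (sE (iota x)) => //; rewrite iK => e; case/eqP: ix; rewrite -(sK (iota x)) e.
have tE y : (tperm (iota x) x * s)%g y = if y \in [set x; iota x] then iota y else s y.
  rewrite permM !inE; case: tpermP => [->|->|/eqP/negPf -> /eqP/negPf -> //].
    by rewrite eqxx orbT iK.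
  by rewrite eqxx.
exists (tperm (iota x) x * s)%g; split.
- move=> y; rewrite (tE y); case: ifP => yx; rewrite tE.
    suff -> : iota y \in [set x; iota x] by rewrite iK.
    by move: yx; rewrite !inE => /orP[] /eqP ->; rewrite ?iK eqxx ?orbT.
  suff /negPf -> : s y \notin [set x; iota x] by rewrite sK.
  apply: contraFN yx; rewrite !inE => /orP[] /eqP e.
    by rewrite -[y]sK e sx eqxx.
  by rewrite -[y]sK e six eqxx orbT.
- by move=> y; rewrite tE; case: ifP => _; auto.
- have -> : moved (tperm (iota x) x * s)%g = [set x; iota x] :|: moved s.
    apply/setP => y; rewrite !inE tE !inE.
    case: ifP => //= /orP[] /eqP ->; rewrite ?ix ?iK ?(eq_sym x) ?ix //.
  rewrite cardsU (_ : _ :&: _ = finset.set0) ?cards0 ?cards2 1?(eq_sym x) ?ix; last first.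
    apply/setP => y; rewrite !inE; apply: negbTE.
    by apply/negP => /andP[/orP[] /eqP ->]; rewrite ?sx ?six eqxx.
  by rewrite ms; lia.
- by rewrite -perm_mulgA; move: merge => *; lia.
Qed.

Lemma exists_tree_part (T : finType) (theta iota : {perm T}) (x0 : T) :
    involutive iota ->
    [transitive <<[set theta; iota]>>%g, on [set: T] | 'P] ->
  exists s : {perm T},
    [/\ involutive s, forall x, s x = x \/ s x = iota x,
        #|moved s| + 2 = 2 * cycles theta & cycles (s * theta)%g = 1].
Proof.
move=> iK tr.
have c0 : 0 < cycles theta.
  by apply/card_gt0P; exists (porbit theta x0); apply: imset_f.
(* A tree whose vertices are the cycles of [theta] has one edge fewer than vertices. *)
have [s [? ? ms cs]] := exists_partial_tree_part iK tr (j := (cycles theta).-1) ltac:(lia).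
by exists s; split => //; lia.
Qed.

(** * Noncrossing involutions along the contour *)

(** Conjugation by [g] turns a permutation of points into one of positions on the contour, where the
    order of ['I_N] is meaningful. *)
Lemma full_cycle_enum N (z : 'S_N) (r : 'I_N) : cycles z = 1 ->
  exists g : 'S_N, forall i, g i = iter i z r.
Proof.
move=> z1; have zr := porbit_full r z1.
have := uniq_traject_porbit z r; rewrite zr cardsT card_ord => /uniqP u.
have ginj : injective (fun i : 'I_N => iter i z r).
  move=> i j /= e; apply/val_inj/(u r); rewrite ?inE ?size_traject ?ltn_ord //.
  by rewrite !nth_traject ?ltn_ord /=.
by exists (perm ginj) => i; rewrite permE.
Qed.

Definition noncrossing N (f : 'S_N) :=
  forall i j : 'I_N, ~ [/\ i < j, j < f i & f i < f j].

(** Multiplying the full cycle [z] by [m] transpositions gives at most [m + 1] cycles. The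
    hypothesis says that this maximum is reached, so no transposition may ever merge two cycles. *)
Lemma noncrossing_conj N (z g t : 'S_N) (r : 'I_N) :
    (forall i, g i = iter i z r) ->
    cycles z = 1 -> involutive t -> #|moved t| + 2 <= 2 * cycles (t * z)%g ->
  noncrossing (g * t * g^-1)%g.
Proof.
move=> gE z1 tK tz i j [].
set k := (g * t * g^-1)%g i; set l := (g * t * g^-1)%g j => ij jk kl.
have gk : g k = t (g i) by rewrite /k !permM permKV.
have gl : g l = t (g j) by rewrite /l !permM permKV.
have ti : t (g i) != g i.
  by rewrite -gk (inj_eq perm_inj); apply/eqP => e; move: ij jk; rewrite e => *; lia.
have [t1 [t1K _ tE t1E mt1]] := involutive_tperm_mul tK ti.
have t1j : t1 (g j) = t (g j).
  by rewrite t1E -gk !inE !(inj_eq perm_inj) -!val_eqE /= gtn_eqF // ltn_eqF.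
have t1jN : t1 (g j) != g j.
  by rewrite t1j -gl (inj_eq perm_inj) -val_eqE /= gtn_eqF //; lia.
have [t2 [t2K _ t2E _ mt2]] := involutive_tperm_mul t1K t1jN.
set u := (tperm (g i) (t (g i)) * z)%g.
(* The arc at [i] cuts the contour into two cycles, and a crossing arc at [j] glues
   them back: two transpositions of [t] are spent without gaining a cycle. *)
have uN : g j \notin porbit u (t1 (g j)).
  (* With the arc from [i] to [k] inserted, the walk at [k] resumes at [i + 1], so the positions in
     [(i, k]] are closed under [u]; [j] is among them, [l] is not. *)
  pose S := [set x | i < (g^-1)%g x <= k].
  have Sg (m : 'I_N) : (g m \in S) = (i < m <= k) by rewrite inE permK.
  have US x : x \in S -> u x \in S.
    have [m ->] : exists m, x = g m by exists (g^-1 x)%g; rewrite permKV.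
    rewrite Sg => /andP[im mk].
    have zg (a b : 'I_N) : a.+1 = b :> nat -> z (g a) = g b by rewrite !gE => <-.
    rewrite permM -gk; case: tpermP => [/perm_inj mi|_|_ /eqP mk'].
    - by move: im; rewrite mi ltnn.
    - have iN : i.+1 < N by have := ltn_ord j; move: (ij) => *; lia.
      by rewrite (zg i (Ordinal iN)) // Sg /=; move: ij jk => *; lia.
    - rewrite (inj_eq perm_inj) -val_eqE /= in mk'.
      have mN : m.+1 < N by have := ltn_ord k => *; lia.
      by rewrite (zg m (Ordinal mN)) // Sg /=; lia.
  rewrite porbit_sym t1j -gl; apply/negP => /(fintype.subsetP (porbit_subset US _)).
  by rewrite !Sg => /(_ ltac:(lia)); lia.
have := cycles_tperm_mul u (g j) (t1 (g j)).
rewrite /= uN eq_sym t1jN /= => c2.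
have c1 := cycles_tperm_mul_le (g i) (t (g i)) z; rewrite -/u in c1.
have c3 := cycles_involutive_mul_le (tperm (g j) (t1 (g j)) * u)%g t2K.
have e : (t2 * (tperm (g j) (t1 (g j)) * u) = t * z)%g.
  by rewrite /u !perm_mulgA -t2E -tE.
by rewrite e in c3; lia.
Qed.

(** Parenthesis matching from the left. At the first closer [y] where the partners differ, take the
    later of the two: the other involution matches it either before [y], against minimality, or
    after [y], which makes a crossing. *)
Lemma noncrossing_inj N (f1 f2 : 'S_N) :
    involutive f1 -> involutive f2 -> noncrossing f1 -> noncrossing f2 ->
    (forall i : 'I_N, (i < f1 i) = (i < f2 i)) ->
    (forall i : 'I_N, (f1 i < i) = (f2 i < i)) -> f1 = f2.
Proof.
move=> K1 K2 nc1 nc2 op cl.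
have clE m (y : 'I_N) : y <= m -> f1 y < y -> f1 y = f2 y.
  elim/ltn_ind: m y => m IH y ym y1; have y2 : f2 y < y by rewrite -cl.
  apply/val_inj; case: (ltngtP (f1 y) (f2 y)) => // lt.
  - have o1 : f2 y < f1 (f2 y) by rewrite op K2.
    case: (ltngtP (f1 (f2 y)) y) => [by'|yb|/val_inj e].
    + have := IH (f1 (f2 y)) ltac:(lia) _ (leqnn _); rewrite K1 => /(_ o1) e.
      by move: by'; rewrite -[f1 _]K2 -e K2 ltnn.
    + by case: (nc1 (f1 y) (f2 y)); rewrite K1.
    + by move: lt; rewrite -e K1 e ltnn.
  - have o1 : f1 y < f2 (f1 y) by rewrite -op K1.
    case: (ltngtP (f2 (f1 y)) y) => [by'|yb|/val_inj e].
    + have := IH (f2 (f1 y)) ltac:(lia) _ (leqnn _); rewrite cl K2 => /(_ o1) e.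
      by move: by'; rewrite -[f2 _]K1 e K1 ltnn.
    + by case: (nc2 (f2 y) (f1 y)); rewrite K2.
    + by move: lt; rewrite -e K2 e ltnn.
apply/permP => y; case: (ltngtP (f1 y) y) => [lt|lt|/val_inj e].
- exact: clE (leqnn _) lt.
- have := clE _ _ (leqnn (f1 y)); rewrite K1 => /(_ lt) e.
  by rewrite {2}e K2.
- apply/esym/val_inj; rewrite e; case: (ltngtP (f2 y) y) => //.
    by rewrite -cl e ltnn.
  by rewrite -op e ltnn.
Qed.

Definition openers N (f : 'S_N) : {set 'I_N} := [set i : 'I_N | i < f i].

Lemma card_moved_openers N (f : 'S_N) : involutive f -> #|moved f| = 2 * #|openers f|.
Proof.
move=> fK; rewrite -(cardsID (openers f) (moved f)) mul2n -addnn; congr addn.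
  congr (#|pred_of_set _|); apply/finset.setIidPr/fintype.subsetP => i.
  by rewrite !inE -val_eqE /=; lia.
rewrite -(card_imset (openers f) (@perm_inj _ f)).
congr (#|pred_of_set _|); apply/setP => i; apply/idP/imsetP => [|[j jo ->]].
  rewrite !inE -val_eqE => h; exists (f i); rewrite ?fK //.
  by rewrite inE fK /=; move: h => /=; lia.
by move: jo; rewrite !inE fK -val_eqE /=; lia.
Qed.

(** * Encoding and decoding an element of [Map0] *)

(* [s] is the spanning-tree part of [iota], and [g] lists the points in the order
   in which the contour of the tree visits them. *)
Definition explores N (theta : 'S_N) (r : 'I_N) (iota s g : 'S_N) : Prop :=
  [/\ involutive s, forall x, s x = x \/ s x = iota x,
      forall i, g i = iter i (s * theta)%g r,
      noncrossing (g * s * g^-1)%g & noncrossing (g * (s * iota) * g^-1)%g].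

Lemma Map0_involutive N (theta iota : 'S_N) : iota \in Map0 theta ->
  involutive iota /\ forall x, iota x != x.
Proof.
rewrite inE => /and4P[/forallP ix /eqP i2 _ _]; split=> // x.
by have := expg_order iota; rewrite i2 expgS expg1 => /permP/(_ x); rewrite permM perm1.
Qed.

Lemma conj_involutive N (g s : 'S_N) : involutive s -> involutive (g * s * g^-1)%g.
Proof. by move=> sK x; rewrite !permM permKV sK permK. Qed.

Lemma tree_complement N (iota s : 'S_N) :
    involutive iota -> involutive s -> (forall x, s x = x \/ s x = iota x) ->
  forall x, (s * iota)%g x = if s x == x then iota x else x.
Proof.
move=> iK sK sE x; rewrite permM; case: eqP => [-> //|]; case: (sE x) => // -> _.
exact: iK.
Qed.

Lemma tree_complement_involutive N (iota s : 'S_N) :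
    involutive iota -> involutive s -> (forall x, s x = x \/ s x = iota x) ->
  involutive (s * iota)%g.
Proof.
move=> iK sK sE x; have E := tree_complement iK sK sE; rewrite (E x).
case: eqP => sx; rewrite E.
  have -> : s (iota x) == iota x.
    case: (sE (iota x)) => [->|]; first exact: eqxx.
    by rewrite iK => e; rewrite -[iota x]sK e !sx eqxx.
  exact: iK.
by case: eqP.
Qed.

Lemma exists_explores N (theta iota : 'S_N) (r : 'I_N) : iota \in Map0 theta ->
  exists s g, explores theta r iota s g /\ #|moved s| + 2 = 2 * cycles theta.
Proof.
move=> iM; have [iK ix] := Map0_involutive iM.
move: iM; rewrite inE => /and4P[_ _ tr /eqP genus].
rewrite -/(cycles theta) -/(cycles (iota * theta)%g) in genus.
have [s [sK sE ms cs]] : exists s : 'S_N,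
    [/\ involutive s, forall x, s x = x \/ s x = iota x,
        #|moved s| + 2 = 2 * cycles theta & cycles (s * theta)%g = 1].
  exact: exists_tree_part r iK tr.
have [g gE] := full_cycle_enum r cs.
have tK := tree_complement_involutive iK sK sE.
exists s, g; split=> //; split=> //.
  (* Undoing the tree gives back [theta], which has one cycle more than [s] has transpositions. *)
  apply: (noncrossing_conj gE cs sK).
  suff -> : (s * (s * theta) = theta)%g by rewrite ms.
  by apply/permP => x; rewrite !permM sK.
(* The genus-zero relation enters here: [s * iota] moves [N - 2 c(theta) + 2] points, and
   [c(iota * theta) = 2 + N/2 - c(theta)] is exactly the required number of cycles. *)
apply: (noncrossing_conj gE cs tK).
have -> : (s * iota * (s * theta) = iota * theta)%g.
  rewrite perm_mulgA; congr (_ * _)%g; apply/permP => x.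
  have := tK (s x); rewrite !permM sK => e.
  by rewrite -e iK sK.
have mi : #|moved (s * iota)%g| + #|moved s| = N.
  rewrite -[RHS]card_ord -(cardsC (moved s)) addnC; congr addn.
  congr (#|pred_of_set _|); apply/setP => x.
  rewrite !inE (tree_complement iK sK sE) negbK.
  by case: (s x == x); rewrite ?ix ?eqxx.
have Ni : N = 2 * #|openers iota|.
  rewrite -card_moved_openers // -[LHS]card_ord -cardsT.
  by congr (#|pred_of_set _|); apply/setP => x; rewrite !inE ix.
have : N./2 = #|openers iota| by rewrite {1}Ni mul2n doubleK.
by move: genus Ni mi ms => *; lia.
Qed.

(** Decoding: the bits determine both noncrossing involutions of positions, then the walk is rebuilt
    step by step, and with it [iota]. The last hypothesis is conditional because entry points are
    listed along the tree openers, and such lists compare only once the openers agree. *)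
Lemma explores_inj N (theta : 'S_N) (r : 'I_N) (i1 s1 g1 i2 s2 g2 : 'S_N) :
    i1 \in Map0 theta -> i2 \in Map0 theta ->
    explores theta r i1 s1 g1 -> explores theta r i2 s2 g2 ->
    (forall i, (s1 (g1 i) != g1 i) = (s2 (g2 i) != g2 i)) ->
    (forall i : 'I_N, (i < (g1 * i1 * g1^-1)%g i) = (i < (g2 * i2 * g2^-1)%g i)) ->
    (openers (g1 * s1 * g1^-1)%g = openers (g2 * s2 * g2^-1)%g ->
     {in openers (g1 * s1 * g1^-1)%g, forall i, s1 (g1 i) = s2 (g2 i)}) ->
  i1 = i2.
Proof.
move=> /Map0_involutive[iK1 ix1] /Map0_involutive[iK2 ix2].
move=> [sK1 sE1 gE1 sN1 tN1] [sK2 sE2 gE2 sN2 tN2] tree op entry.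
have idx (g s : 'S_N) i : (g * s * g^-1)%g i = (g^-1 (s (g i)))%g by rewrite !permM.
have idx_fix (g s : 'S_N) i : s (g i) = g i -> (g * s * g^-1)%g i = i.
  by move=> e; rewrite idx e permK.
have idx_eq (g s t : 'S_N) i : s (g i) = t (g i) -> (g * s * g^-1)%g i = (g * t * g^-1)%g i.
  by move=> e; rewrite !idx e.
(* Without fixed points a position that is not an opener is a closer, so one bit suffices. *)
have cl i : ((g1 * i1 * g1^-1)%g i < i) = ((g2 * i2 * g2^-1)%g i < i).
  have neq (g s : 'S_N) : (forall x, s x != x) ->
      ((g * s * g^-1)%g i < i) = ~~ (i < (g * s * g^-1)%g i).
    move=> sx; rewrite -leqNgt ltn_neqAle val_eqE idx.
    by rewrite (canF_eq (permKV g)) sx.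
  by rewrite !neq ?op.
have treeE (io s g : 'S_N) i : (forall x, s x = x \/ s x = io x) ->
    (g * s * g^-1)%g i = if s (g i) != g i then (g * io * g^-1)%g i else i :> 'I_N.
  move=> sE; case: eqP => [/idx_fix //|]; case: (sE (g i)) => // e _.
  exact: idx_eq.
have restE (io s g : 'S_N) i :
    involutive io -> involutive s -> (forall x, s x = x \/ s x = io x) ->
    (g * (s * io) * g^-1)%g i = if s (g i) != g i then i else (g * io * g^-1)%g i :> 'I_N.
  move=> ioK sK sE; have := tree_complement ioK sK sE (g i).
  by case: eqP => /= [_ /idx_eq | _ /idx_fix].
have fE : (g1 * s1 * g1^-1 = g2 * s2 * g2^-1)%g.
  apply: noncrossing_inj; rewrite //; try exact: conj_involutive.
    by move=> i; rewrite !(treeE _ _ _ _ sE1) !(treeE _ _ _ _ sE2) tree; case: ifP.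
  by move=> i; rewrite !(treeE _ _ _ _ sE1) !(treeE _ _ _ _ sE2) tree; case: ifP.
have hE : (g1 * (s1 * i1) * g1^-1 = g2 * (s2 * i2) * g2^-1)%g.
  apply: noncrossing_inj; rewrite //;
    try exact: conj_involutive (tree_complement_involutive _ _ _).
    by move=> i; rewrite !(restE _ _ _ _ iK1 sK1 sE1) !(restE _ _ _ _ iK2 sK2 sE2) tree;
       case: ifP.
  by move=> i; rewrite !(restE _ _ _ _ iK1 sK1 sE1) !(restE _ _ _ _ iK2 sK2 sE2) tree;
     case: ifP.
have gE : g1 = g2.
  apply/permP => -[m]; elim/ltn_ind: m => -[|m] IH lt_m; first by rewrite gE1 gE2.
  have lt_m' : m < N by exact: ltnW.
  pose j := Ordinal lt_m'.
  have next (s g : 'S_N) : (forall i, g i = iter i (s * theta)%g r) ->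
      g (Ordinal lt_m) = theta (s (g j)).
    by move=> gE; rewrite !gE /= permM.
  rewrite (next s1) // (next s2) //; congr (theta _).
  (* At a tree opener the next vertex is new and its entry point is given; elsewhere [s] leads to a
     position at most [j], known by induction. *)
  case: (ltnP j ((g1 * s1 * g1^-1)%g j)) => [lt|le].
    by apply: entry; rewrite ?fE // inE -fE.
  have back (g s : 'S_N) : s (g j) = g ((g * s * g^-1)%g j) by rewrite idx permKV.
  rewrite back (back g2) -fE; case: ((g1 * s1 * g1^-1)%g j) le => l lt_l /= le.
  exact: IH.
apply/permP => x; have [i ->] : exists i, x = g1 i by exists (g1^-1 x)%g; rewrite permKV.
move: fE hE; rewrite gE => /mulIg/mulgI -> /mulIg/mulgI/mulgI ->.
by [].
Qed.

(** * Counting the codes, and multinomial estimates *)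

Lemma bin_le_exp2 n m : 'C(n, m) <= 2 ^ n.
Proof.
rewrite -{1}(card_ord n) -card_draws -[n in 2 ^ n]card_ord -cardsT -card_powerset.
by apply/subset_leq_card/fintype.subsetP => A _; rewrite powersetE finset.subsetT.
Qed.

Lemma card_Map0_le N (theta : 'S_N) : 0 < N ->
  #|Map0 theta| <= 8 ^ N * (cycles theta)`!.
Proof.
move=> N0; pose r := Ordinal N0.
pose M := (cycles theta).-1.
have /choice[sg sgP] : forall iota : 'S_N, exists p : 'S_N * 'S_N,
    iota \in Map0 theta ->
    explores theta r iota p.1 p.2 /\ #|moved p.1| + 2 = 2 * cycles theta.
  move=> iota; have [iM|] := boolP (iota \in Map0 theta); last by exists (1, 1)%g.
  by have [s [g h]] := exists_explores r iM; exists (s, g).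
pose idx (iota : 'S_N) : 'S_N := ((sg iota).2 * (sg iota).1 * (sg iota).2^-1)%g.
(* On [Map0] there are exactly [M] tree openers, so the default [r] of [nth] is never returned. *)
pose entry (iota : 'S_N) : {ffun 'I_M -> 'I_N} :=
  [ffun m : 'I_M => (sg iota).1 ((sg iota).2 (nth r (enum (openers (idx iota))) m))].
pose word (iota : 'S_N) : {ffun 'I_N -> bool * bool} :=
  [ffun i : 'I_N => ((sg iota).1 ((sg iota).2 i) != (sg iota).2 i,
                     i < ((sg iota).2 * iota * (sg iota).2^-1)%g i)].
have cardo iota : iota \in Map0 theta -> #|openers (idx iota)| = M.
  move=> /sgP[[sK _ _ _ _] ms].
  have := card_moved_openers (conj_involutive (sg iota).2 sK).
  have -> : #|moved (idx iota)| = #|moved (sg iota).1|.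
    rewrite -(card_imset _ (@perm_inj _ (sg iota).2)); congr (#|pred_of_set _|).
    apply/setP => x; rewrite inE; apply/imsetP/idP => [[y + ->]|sx].
      by rewrite inE /idx !permM (canF_eq (permKV _)).
    exists ((sg iota).2^-1 x)%g; rewrite ?permKV // inE /idx !permM permKV.
    by rewrite (inj_eq perm_inj).
  move=> e; move: ms; rewrite e /M; move: #|_| (cycles _) => a b *; lia.
pose E := [set e : {ffun 'I_M -> 'I_N} | injectiveb e].
have sub : [set (word iota, entry iota) | iota in Map0 theta] \subset
    finset.setX [set: {ffun 'I_N -> bool * bool}] E.
  apply/fintype.subsetP => _ /imsetP[iota iM ->]; rewrite inE finset.in_setT /= inE.
  apply/injectiveP => m m'; rewrite !ffunE => /perm_inj/perm_inj/eqP.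
  by rewrite nth_uniq ?enum_uniq -?cardE ?cardo ?ltn_ord // => /eqP/val_inj.
have inj : {in Map0 theta &, injective (fun iota => (word iota, entry iota))}.
  move=> i1 i2 M1 M2 [] /ffunP w /ffunP e.
  have [ex1 _] := sgP _ M1; have [ex2 _] := sgP _ M2.
  have w1 i : ((sg i1).1 ((sg i1).2 i) != (sg i1).2 i) =
      ((sg i2).1 ((sg i2).2 i) != (sg i2).2 i).
    by have := w i; rewrite !ffunE => -[].
  have w2 (i : 'I_N) : (i < ((sg i1).2 * i1 * (sg i1).2^-1)%g i) =
      (i < ((sg i2).2 * i2 * (sg i2).2^-1)%g i).
    by have := w i; rewrite !ffunE => -[].
  apply: (explores_inj M1 M2 ex1 ex2) => // oE i; rewrite -mem_enum => io.
  have lt : index i (enum (openers (idx i1))) < M by rewrite -(cardo _ M1) cardE index_mem.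
  by have := e (Ordinal lt); rewrite !ffunE /= /idx -oE nth_index.
rewrite -(card_in_imset inj); apply: leq_trans (subset_leq_card sub) _.
rewrite cardsX cardsT card_ffun card_prod card_bool card_ord card_inj_ffuns !card_ord.
(* [4 ^ N] counts the pairs of bits; the other [2 ^ N] bounds the binomial in
   [N ^_ M = 'C(N, M) * M!]. *)
have -> : 8 ^ N = (2 * 2) ^ N * 2 ^ N by rewrite -expnMn.
by rewrite -mulnA -bin_ffact !leq_mul ?bin_le_exp2 // leq_fact // leq_pred.
Qed.

Lemma fact_addn_le a b : (a + b)`! <= 2 ^ (a + b) * (a`! * b`!).
Proof.
by rewrite -(bin_fact (leq_addr b a)) addKn leq_mul2r bin_le_exp2 orbT.
Qed.

(** Peeling off one term at a time, each binomial coefficient costs at most 2 to the power of the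
    whole sum. *)
Lemma fact_sum_le (I : Type) (s : seq I) (nu : I -> nat) :
  (\sum_(i <- s) nu i)`! <= 2 ^ (size s * \sum_(i <- s) nu i) * \prod_(i <- s) (nu i)`!.
Proof.
elim: s => [|i s IH]; rewrite ?big_nil // !big_cons /=.
apply: leq_trans (fact_addn_le _ _) _.
rewrite mulSn [X in _ <= X * _]expnD -[X in _ <= X]mulnA leq_mul2l.
apply/orP; right; rewrite mulnCA leq_mul2l; apply/orP; right.
apply: leq_trans IH _; rewrite leq_mul2r leq_exp2l // leq_mul2l leq_addl.
by rewrite !orbT.
Qed.

Lemma cycles_blocks k (n : 'I_k -> nat) (nu : 'I_k -> nat) N (theta : 'S_N) :
  perm_eq (cycle_type theta) (blocks n nu) -> cycles theta = \sum_i nu i.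
Proof.
move/perm_size; rewrite /cycles size_map -cardE /blocks size_flatten /shape -map_comp => ->.
rewrite sumnE big_map big_enum /=; apply: eq_bigr => i _.
by rewrite size_nseq.
Qed.

Lemma card_Map0_blocks_le k (n : 'I_k -> nat) :
  exists2 C, 0 < C & forall (nu : 'I_k -> nat) (theta : 'S_(\sum_(i < k) nu i * n i)),
    0 < \sum_(i < k) nu i * n i -> perm_eq (cycle_type theta) (blocks n nu) ->
    #|Map0 theta| <= \prod_i (C ^ nu i * (nu i)`!).
Proof.
(* The first factor comes from [N <= (\sum_i n i) * (\sum_i nu i)], the second from the multinomial
   estimate with [k] terms. *)
exists (8 ^ (\sum_i n i) * 2 ^ k); first by rewrite muln_gt0 !expn_gt0.
move=> nu theta N0 /cycles_blocks cE; apply: leq_trans (card_Map0_le theta N0) _.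
rewrite cE big_split /= -expn_sum expnMn -mulnA leq_mul //.
  rewrite -expnM leq_exp2l // big_distrr /= leq_sum // => i _.
  by rewrite mulnC leq_mul2r (bigD1 i) //= leq_addr orbT.
have := fact_sum_le (index_enum 'I_k) nu.
by rewrite -expnM /index_enum -enumT size_enum_ord.
Qed.

(** * Absolute convergence *)

Import Order.TTheory GRing.Theory Num.Theory.
Local Open Scope ring_scope.

Lemma normcX (R : rcfType) (z : R[i]) m : Normc.normc (z ^+ m) = Normc.normc z ^+ m.
Proof.
by elim: m => [|m IH]; rewrite ?Normc.normc1 // !exprS Normc.normcM IH.
Qed.

Lemma normc_prod (R : rcfType) (I : Type) (s : seq I) (z : I -> R[i]) :
  Normc.normc (\prod_(i <- s) z i) = \prod_(i <- s) Normc.normc (z i).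
Proof.
elim: s => [|i s IH]; rewrite ?big_nil ?Normc.normc1 // !big_cons.
by rewrite Normc.normcM IH.
Qed.

Lemma normc_nat (R : rcfType) m : Normc.normc (m%:R : R[i]) = m%:R.
Proof.
have -> : (m%:R : R[i]) = (m%:R)%:C%C by rewrite rmorph_nat.
by rewrite /Normc.normc /= expr0n addr0 sqrtr_sqr normr_nat.
Qed.

(** The finitely many exponents lie in a box, over which the sum factors into [k] truncated
    geometric series, each at most 2. *)
Lemma geometric_box_sum_le (R : realType) k (s : seq {ffun 'I_k -> nat}) :
  uniq s -> \sum_(nu <- s) \prod_(i < k) (2^-1 : R) ^+ nu i <= 2 ^+ k.
Proof.
move=> us; pose B := (\max_(nu <- s) \max_i nu i)%N.
have leB nu i : nu \in s -> (nu i <= B)%N.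
  move=> nus; rewrite /B (big_rem nu) //= leq_max; apply/orP; left.
  exact: leq_bigmax.
pose h (nu : {ffun 'I_k -> nat}) : {ffun 'I_k -> 'I_B.+1} := [ffun i => inord (nu i)].
have hE nu i : nu \in s -> h nu i = nu i :> nat.
  by move=> nus; rewrite ffunE inordK // ltnS leB.
have h_inj : {in s &, injective h}.
  by move=> nu nu' s1 s2 e; apply/ffunP => i; rewrite -hE // e hE.
have -> : \sum_(nu <- s) \prod_(i < k) (2^-1 : R) ^+ nu i =
    \sum_(f <- map h s) \prod_(i < k) (2^-1 : R) ^+ f i.
  rewrite big_map !big_seq; apply: eq_bigr => nu nus.
  by apply: eq_bigr => i _; rewrite hE.
rewrite big_uniq ?map_inj_in_uniq //=.
apply: (@le_trans _ _ (\sum_(f : {ffun 'I_k -> 'I_B.+1}) \prod_(i < k) (2^-1 : R) ^+ f i)).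
  rewrite big_mkcond /= ler_sum // => f _; case: ifP => // _.
  by apply: prodr_ge0 => i _; rewrite exprn_ge0.
rewrite -(bigA_distr_bigA (fun _ (j : 'I_B.+1) => (2^-1 : R) ^+ j)) /=.
rewrite -[k in leRHS]card_ord -prodr_const; apply: ler_prod => i _.
rewrite sumr_ge0 //=.
have := subrX1 (2^-1 : R) B.+1.
have : (0:R) <= 2^-1 ^+ B.+1 by rewrite exprn_ge0.
set S := \sum_(_ < _) _; move=> p e; have : 2^-1 ^+ B.+1 = 1 - S/2 :> R.
  by apply/eqP; rewrite -subr_eq0 -[X in X - _](subrK 1) e; apply/eqP; field.
by move=> e'; move: p; rewrite e'; lra.
Qed.

Local Open Scope classical_set_scope.

Lemma summable_geometric (R : realType) k (A : set {ffun 'I_k -> nat})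
    (a : {ffun 'I_k -> nat} -> \bar R) :
    (forall nu, A nu -> (`|a nu| <= (\prod_(i < k) (2^-1 : R) ^+ nu i)%:E)%E) ->
  summable A a.
Proof.
move=> a_le; rewrite /summable; apply: le_lt_trans (ltry (2 ^+ k)).
apply: le_trans (le_esum a_le) _; apply: ge_ereal_sup => _ [X [Xfin _] <-].
rewrite fsbig_finite //= sumEFin lee_fin.
exact/geometric_box_sum_le/finmap.fset_uniq.
Qed.

Lemma near0_coord_normc_lt (R : realType) k (e : R) : 0 < e ->
  \forall z \near (0 : 'rV[R[i]^o]_k), forall i, Normc.normc ((z : 'rV[R[i]]_k) ord0 i) < e.
Proof.
move=> e0; apply/nbhs_ballP; exists (e%:C)%C; first by rewrite /= ltcR.
move=> z [_ bz] i; have := bz ord0 i. rewrite /ball /=.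
by rewrite mxE sub0r normrN normc_def ltcR /Normc.normc; case: (z ord0 i).
Qed.

(* [R[i]^o] is the field of complex numbers with the topology of its modulus, and
   ['rV[R[i]^o]_k] carries the product topology. *)
Theorem corollary1p3 (R : realType) (k : nat) (n : 'I_k -> nat)
    (theta : forall nu : {ffun 'I_k -> nat}, 'S_(\sum_(i < k) nu i * n i)%N)
    (k_ge1 : (1 <= k)%N)
    (n_gt0 : forall i, (0 < n i)%N)
    (thetaP : forall nu : {ffun 'I_k -> nat}, (forall i, (0 < nu i)%N) ->
       perm_eq (cycle_type (theta nu)) (blocks n nu)) :
  \forall z \near (0 : 'rV[R[i]^o]_k),
    abs_convergent [set nu : {ffun 'I_k -> nat} | forall i, (0 < nu i)%N]
      (fun nu : {ffun 'I_k -> nat} =>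
         #|Map0 (theta nu)|%:R * monomial_exp (z : 'rV[R[i]]_k) nu).
Proof.
have [C C_gt0 C_bound] := card_Map0_blocks_le n.
(* In this polydisc [C * |z_i| <= 1/2], so the terms are dominated by a geometric series. *)
have e0 : 0 < (2 * C%:R)^-1 :> R by rewrite invr_gt0 mulr_gt0 // ltr0n.
near=> z.
have z_lt : forall i, Normc.normc (z ord0 i : R[i]) < (2 * C%:R)^-1.
  by near: z; exact: near0_coord_normc_lt.
apply: summable_geometric => nu nu_gt0; rewrite /= in nu_gt0.
have normc_ge0 (w : R[i]) : 0 <= Normc.normc w by case: w => a b; exact: sqrtr_ge0.
rewrite lee_fin ger0_norm // Normc.normcM normc_nat /monomial_exp.
rewrite Normc.normcM Normc.normcV !normc_prod.
under eq_bigr do rewrite normcX.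
under [X in _ / X]eq_bigr do rewrite normc_nat.
have fact_pos : 0 < \prod_i ((nu i)`!%:R : R).
  by apply: prodr_gt0 => i _; rewrite ltr0n fact_gt0.
rewrite mulrA ler_pdivrMr //.
have N0 : (0 < \sum_(i < k) nu i * n i)%N.
  by rewrite (bigD1 (Ordinal k_ge1)) //= addn_gt0 muln_gt0 nu_gt0 n_gt0.
have := C_bound nu (theta nu) N0 (thetaP nu nu_gt0).
rewrite -(ler_nat R) => /ler_wpM2r bound.
apply: le_trans (bound _ _) _; first by apply: prodr_ge0 => i _; rewrite exprn_ge0.
(* The factorials in the bound match those of the denominator, so the comparison reduces to one
   coordinate. *)
rewrite natr_prod -!big_split /=; apply: ler_prod => i _.
rewrite mulr_ge0 ?exprn_ge0 //= natrM natrX mulrAC ler_wpM2r // -exprMn.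
rewrite lerXn2r ?nnegrE ?mulr_ge0 //.
by have := ltW (z_lt i); rewrite -div1r ler_pdivlMr ?mulr_gt0 ?ltr0n // => h; lra.
Unshelve. all: by end_near.
Qed.
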